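(* There is a universal constant $c_{\rm pol}>0$ such that the following holds. Let $T=2K\ge 4$ be an even integer and $0<\epsilon\le T/128$. Consider the class of backlog inventory instances with horizon $T$, independent demands $D_1,\ldots,D_T$ each supported on $\{0,1\}$ (with unknown laws $P_1,\ldots,P_T$), zero ordering cost and lead time, and $h_t=p_t=1$ for $t=1,\ldots,T$. An algorithm may request observations sequentially: before request $m$, it chooses a period index $A_m\in\{1,\ldots,T\}$ as an arbitrary randomized function of its internal seed and all preceding indices and observations, and then receives a fresh draw from the period-$A_m$ demand law $P_{A_m}$. It stops after at most $M$ scalar observations and returns an arbitrary feasible, possibly randomized policy $\widehat\pi$. If, on every instance in the class, its returned policy is $\epsilon$-optimal from $x_1=0$, i.e. $V_1^{\widehat\pi}(0)-V_1^*(0)\le\epsilon$, with probability at least $3/4$, then $$M\ge c_{\rm pol}\frac{T^3}{\epsilon^2}.$$ The conclusion also holds if the action constraint $y_t\ge\max\{x_t,0\}$ is replaced by the conventional backlog action constraint $y_t\ge x_t$, which permits negative post-order levels.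
   Context: Backlog inventory model. Horizon $T$; write $u^+=\max\{u,0\}$. Demands $D_1,\ldots,D_T$ are independent with laws $P_t$. Holding and shortage coefficients $h_t,p_t>0$ are known. Fixed and per-unit ordering costs, lead time, and terminal salvage value are all zero. Starting period $t$ with inventory $x_t$, the retailer chooses a post-order level $y_t\ge\max\{x_t,0\}$ before observing $D_t$, and incurs the cost $c_t(y_t,D_t)$ with $c_t(y,d)=h_t(y-d)^++p_t(d-y)^+$. The next state is $x_{t+1}=y_t-D_t$, and the demand $D_t$ is then observed. A feasible policy $\pi$ chooses each action using the information then available (the history of states, actions and demands); randomization is allowed. $V_t^\pi(x)$ is its expected total cost from period $t$ and state $x$, and $V_t^*(x)=\inf_\pi V_t^\pi(x)$. The algorithm knows the costs and the observation protocol but not the demand laws. A returned policy is deployed on a fresh demand trajectory independent of the offline data; the success probability is over the offline data and the randomization of the algorithm. *)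

(* Defs.v *)
From HB Require Import structures.
From mathcomp Require Import all_boot all_order all_algebra.
From mathcomp Require Import all_classical all_reals all_analysis.
From mathcomp Require Import measurable_realfun.

Set Implicit Arguments.
Unset Strict Implicit.
Unset Printing Implicit Defensive.
Import Order.TTheory GRing.Theory Num.Theory.

Local Open Scope classical_set_scope.
Local Open Scope ring_scope.

(* Periods are numbered from 0 and families indexed by periods are total
   functions on nat, of which a model with horizon T only uses t < T. *)

Variant level_rule := NonnegLevel | BacklogLevel.

Definition min_level (R : realType) (r : level_rule) (x : R) : R :=
  if r is NonnegLevel then Num.max x 0 else x.

Definition pos_part (R : realType) (u : R) : R := Num.max u 0.

Definition period_cost (R : realType) (h p y d : R) : R :=
  h * pos_part (y - d) + p * pos_part (d - y).

(* A law on {0,1} is a probability on bool; the outcome b is the demand b%:R. *)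
Definition demand_laws (R : realType) : Type := nat -> probability bool R.

(* The information before the decision of period t: the triples
   (state, action, demand) of the periods s < t, and the current state. *)
Definition history (R : realType) (t : nat) : Type :=
  (t.-tuple (measurableTypeR R * measurableTypeR R * bool)
   * measurableTypeR R)%type.

Definition extend (R : realType) (t : nat) (hs : history R t)
    (y : R) (d : bool) : history R t.+1 :=
  ([tuple of rcons hs.1 (hs.2, y, d)], y - d%:R).

Record policy (R : realType) (r : level_rule) := Policy {
  action_law : forall t : nat, R.-pker (history R t) ~> (measurableTypeR R) ;
  action_feasible : forall (t : nat) (hs : history R t),
    action_law t hs [set y : R | min_level r hs.2 <= y] = 1%E }.

(* Expected cost of the next n periods.  Drawing the demand of period t from
   P t whatever the history makes the demands independent. *)
Fixpoint cost_to_go (R : realType) (r : level_rule) (hc pc : nat -> R)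
    (P : demand_laws R) (pi : policy R r) (n t : nat) (hs : history R t)
    : \bar R :=
  if n is n'.+1 then
    (\int[action_law pi t hs]_y \int[P t]_d
      ((period_cost (hc t) (pc t) y d%:R)%:E
       + cost_to_go hc pc P pi n' (extend hs y d)))%E
  else 0%E.

Definition policy_value (R : realType) (r : level_rule) (T : nat)
    (hc pc : nat -> R) (P : demand_laws R) (x : R) (pi : policy R r) : \bar R :=
  cost_to_go hc pc P pi T (([tuple], x) : history R 0).

Definition optimal_value (R : realType) (r : level_rule) (T : nat)
    (hc pc : nat -> R) (P : demand_laws R) (x : R) : \bar R :=
  ereal_inf (range (fun pi : policy R r => policy_value T hc pc P x pi)).

Definition eps_optimal (R : realType) (r : level_rule) (T : nat)
    (hc pc : nat -> R) (P : demand_laws R) (x eps : R) : set (policy R r) :=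
  [set pi | (policy_value T hc pc P x pi - optimal_value r T hc pc P x
             <= eps%:E)%E].

(* Requested periods with the demands observed, oldest first. *)
Definition transcript (T : nat) : Type := seq ('I_T * bool).

(* W is the space of the internal seed; the request None means stopping. *)
Record algorithm (R : realType) (r : level_rule) (T : nat)
    (dW : measure_display) (W : measurableType dW) := Algorithm {
  request : W -> transcript T -> option 'I_T ;
  request_measurable : forall (tr : transcript T) (a : option 'I_T),
    measurable [set w | request w tr = a] ;
  returned : W -> transcript T -> policy R r ;
  returned_measurable : forall (tr : transcript T) (t : nat) (B : set R),
    measurable (B : set (measurableTypeR R)) ->
    measurable_fun [set: W * history R t]
      (fun wh : W * history R t =>
         action_law (returned wh.1 tr) t wh.2 B) }.

(* Probability, given the seed w and the transcript tr so far, that the policy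
   returned belongs to G, when at most m further observations are allowed.  An
   algorithm that never makes more than m requests is unaffected by the cap. *)
Fixpoint return_prob (R : realType) (r : level_rule) (T : nat)
    (dW : measure_display) (W : measurableType dW) (A : algorithm R r T W)
    (P : demand_laws R) (G : set (policy R r)) (w : W) (m : nat)
    (tr : transcript T) : \bar R :=
  match m, request A w tr with
  | m'.+1, Some a =>
      (\int[P a]_d return_prob A P G w m' (rcons tr (a, d)))%E
  | _, _ => (\1_G (returned A w tr) : R)%:E
  end.

Definition success_prob (R : realType) (r : level_rule) (T : nat)
    (dW : measure_display) (W : measurableType dW) (mu : probability W R)
    (A : algorithm R r T W) (M : nat) (P : demand_laws R)
    (G : set (policy R r)) : \bar R :=
  (\int[mu]_w return_prob A P G w M [::])%E.

(* Main.v *)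
(* Odd periods (numbered from 0) have demand 1, which resets the inventory; an
   even period t has a fair coin biased by a hidden sign s_t * d with
   d = 4 eps / K.  The optimal policy loses 1/2 - d per even period, and any
   policy pays an extra 2 d times its mean distance to the level dictated by
   s_t, so an eps-optimal policy errs on at most K/8 of the K signs on average.
   The level chosen in period t does not depend on the law of D_t, so flipping
   s_t complements the error in period t.  By Assouad's argument over uniform
   signs it remains to bound a two-point Bayes risk for adaptive sampling from
   below, which is done along the transcript by following the harmonic mean of
   the two likelihoods: each request of t lowers uv/(u+v) by at most
   d^2 (u+v).  All of this holds for every seed, so that averaging over the
   seed only requires the superadditivity of the lower integral. *)
Require Import Defs.
From HB Require Import structures.
From mathcomp Require Import all_boot all_order all_algebra.
From mathcomp Require Import all_classical all_reals all_analysis.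
From mathcomp Require Import measurable_realfun ring lra.

Set Implicit Arguments.
Unset Strict Implicit.
Unset Printing Implicit Defensive.
Import Order.TTheory GRing.Theory Num.Theory.

Local Open Scope classical_set_scope.
Local Open Scope ring_scope.

(** * Adaptive sampling *)

Section SequentialExperiment.
Variables (R : realFieldType) (I : finType).
Variable req : seq (I * bool) -> option I.
Implicit Types (p q : I -> R) (F G : seq (I * bool) -> R).

(** Real-valued form of [return_prob]: once the seed is fixed, sampling is a finite binary tree with
    edge weights [p a] and [1 - p a], and integrals become weighted sums. *)
Fixpoint tree_mean p F (m : nat) (tr : seq (I * bool)) : R :=
  match m, req tr with
  | m'.+1, Some a => p a * tree_mean p F m' (rcons tr (a, true))
                     + (1 - p a) * tree_mean p F m' (rcons tr (a, false))
  | _, _ => F tr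
  end.

(** Expected number of requests of [k]: the information spent on separating two laws that differ
    only at [k]. *)
Fixpoint request_mean p (k : I) (m : nat) (tr : seq (I * bool)) : R :=
  match m, req tr with
  | m'.+1, Some a => (a == k)%:R
                     + (p a * request_mean p k m' (rcons tr (a, true))
                        + (1 - p a) * request_mean p k m' (rcons tr (a, false)))
  | _, _ => 0
  end.

Lemma tree_mean_le p F G (p01 : forall a, 0 <= p a <= 1)
    (FG : forall tr, F tr <= G tr) m tr :
  tree_mean p F m tr <= tree_mean p G m tr.
Proof.
elim: m tr => [|m IH] tr /=; first exact: FG.
case: (req tr) => [a|]; last exact: FG.
have /andP[p0 p1] := p01 a.
by apply: lerD; apply: ler_wpM2l; rewrite ?subr_ge0.
Qed.

Lemma tree_mean_affine p F (a b : R) m tr :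
  tree_mean p (fun x => a + b * F x) m tr = a + b * tree_mean p F m tr.
Proof.
elim: m tr => [|m IH] tr //=.
by case: (req tr) => [c|//]; rewrite !IH; ring.
Qed.

Lemma tree_mean_sum p (J : finType) (D : pred J) (F : J -> seq (I * bool) -> R)
    m tr :
  tree_mean p (fun x => \sum_(j | D j) F j x) m tr
    = \sum_(j | D j) tree_mean p (F j) m tr.
Proof.
elim: m tr => [|m IH] tr //=.
by case: (req tr) => [c|//]; rewrite !IH !mulr_sumr -big_split.
Qed.

(** A request of [a] raises the count of [a] alone, so all counts share the budget [m]. *)
Lemma sum_request_mean_le p (D : pred I) (p01 : forall a, 0 <= p a <= 1) m tr :
  \sum_(k | D k) request_mean p k m tr <= m%:R.
Proof.
elim: m tr => [|m IH] tr /=; first by rewrite big1.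
case: (req tr) => [a|]; last by rewrite big1// ler0n.
have /andP[p0 p1] := p01 a.
rewrite big_split/= -natr1 addrC big_split/= -!mulr_sumr.
apply: lerD.
  have H0 := ler_wpM2l p0 (IH (rcons tr (a, true))).
  have H1 : (1 - p a) * \sum_(k | D k) request_mean p k m (rcons tr (a, false))
      <= (1 - p a) * m%:R by apply: ler_wpM2l; rewrite ?subr_ge0.
  by apply: (le_trans (lerD H0 H1)); rewrite -mulrDl subrKC mul1r.
rewrite big_mkcond (bigD1 a)//= eqxx big1 ?addr0; first by case: ifP.
by move=> k ka; rewrite eq_sym (negbTE ka); case: ifP.
Qed.

(* The risk is at least [min u v], and for [t = v / (u + v)],
   [min (t, 1 - t) - 4 t (1 - t) + 9 / 16 = (2 t - 3 / 4)^2] for [t <= 1/2]. *)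
Lemma bayes_risk_ge (u v x y : R) : 0 <= u -> 0 <= v -> 0 <= x -> 0 <= y ->
  1 <= x + y ->
  4 * (u * v / (u + v)) - 9 / 16 * (u + v) <= u * x + v * y.
Proof.
move=> u0 v0 x0 y0 xy.
have [uv0|uv0] := eqVneq (u + v) 0.
  have [-> ->] : u = 0 /\ v = 0 by split; lra.
  by rewrite !mul0r addr0 !mulr0 subr0.
have uvp : 0 < u + v by rewrite lt_def uv0 addr_ge0.
rewrite -(ler_pM2r uvp) mulrBl -(mulrA 4) divfK//.
wlog uv : u v x y u0 v0 x0 y0 xy uv0 uvp / v <= u.
  move=> H; case: (leP v u) => [|/ltW] uv; first exact: H.
  have := H v u y x v0 u0 y0 x0; rewrite !(addrC v) (mulrC v u).
  by rewrite (addrC y x) (addrC (v * y)); exact.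
have h1 : v <= u * x + v * y.
  have : 0 <= (u - v) * x by rewrite mulr_ge0// subr_ge0.
  have : 0 <= v * (x + y - 1) by rewrite mulr_ge0// subr_ge0.
  lra.
have h2 : v * (u + v) <= (u * x + v * y) * (u + v) by rewrite ler_pM2r.
apply: le_trans h2.
(* The square [(2 t - 3 / 4)^2], cleared of denominators. *)
have : 0 <= (3 * u - 5 * v) ^+ 2 by exact: sqr_ge0.
lra.
Qed.

(** The new likelihood sums [A] and [B] add up to [u + v], so the right side is
    [u v c (u + v) / (A B)], at least [4 u v c / (u + v)] by AM-GM. Here [4 c = 1 - 4 d^2], and the
    lost [4 d^2 u v / (u + v)] is at most [d^2 (u + v)]. *)
Lemma harmonic_step (u v d : R) : 0 <= u -> 0 <= v -> 0 <= d < 2^-1 ->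
  let u1 := (2^-1 + d) * u in let v1 := (2^-1 - d) * v in
  let u0 := (2^-1 - d) * u in let v0 := (2^-1 + d) * v in
  u * v / (u + v) - d ^+ 2 * (u + v)
    <= u1 * v1 / (u1 + v1) + u0 * v0 / (u0 + v0).
Proof.
move=> u0 v0 /andP[d0 d1] /=.
have [uv0|uv0] := eqVneq (u + v) 0.
  have [-> ->] : u = 0 /\ v = 0 by split; lra.
  by rewrite !(mulr0, mul0r, subr0, addr0).
have uvp : 0 < u + v by rewrite lt_def uv0 addr_ge0.
set A := (2^-1 + d) * u + (2^-1 - d) * v.
set B := (2^-1 - d) * u + (2^-1 + d) * v.
have d2 : 0 < 2^-1 - d by rewrite subr_gt0.
have h0 : 0 < (2^-1 - d) * (u + v) by rewrite mulr_gt0.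
have A0 : 0 < A.
  have : 0 <= d * u by rewrite mulr_ge0.
  by rewrite /A; lra.
have B0 : 0 < B.
  have : 0 <= d * v by rewrite mulr_ge0.
  by rewrite /B; lra.
have AB0 : 0 < A * B by rewrite mulr_gt0.
set c := (2^-1 + d) * (2^-1 - d).
have -> : (2^-1 + d) * u * ((2^-1 - d) * v) / A
          + (2^-1 - d) * u * ((2^-1 + d) * v) / B
          = u * v * c * ((u + v) / (A * B)).
  have -> : u + v = A + B by rewrite /A /B; field.
  by rewrite /c; field; rewrite !gt_eqF.
have cE : 4 * c = 1 - 4 * d ^+ 2 by rewrite /c; field.
have c0 : 0 <= c by rewrite mulr_ge0 ?(ltW d2)// addr_ge0 ?invr_ge0.
have uvc : 0 <= u * v * c by apply: mulr_ge0 => //; apply: mulr_ge0.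
have h1 : 4 / (u + v) <= (u + v) / (A * B).
  rewrite ler_pdivrMr// mulrAC ler_pdivlMr//.
  have : 0 <= (A - B) ^+ 2 by exact: sqr_ge0.
  have -> : u + v = A + B by rewrite /A /B; field.
  lra.
apply: (le_trans _ (ler_wpM2l uvc h1)).
have -> : u * v * c * (4 / (u + v)) = u * v / (u + v) * (4 * c) by field.
rewrite cE mulrBr mulr1 lerD2l lerN2.
rewrite [X in X <= _](_ : _ = d ^+ 2 * (4 * (u * v) / (u + v))); last by field.
apply: ler_wpM2l; first exact: sqr_ge0.
rewrite ler_pdivrMr//.
have : 0 <= (u - v) ^+ 2 by exact: sqr_ge0.
lra.
Qed.

(** An observation whose law is common to both hypotheses scales [u] and [v] alike and causes no
    loss. The convention [0^-1 = 0] covers [u + v = 0]. *)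
Lemma harmonicZ (c u v : R) :
  (c * u) * (c * v) / (c * u + c * v) = c * (u * v / (u + v)).
Proof.
have [->|c0] := eqVneq c 0; first by rewrite !mul0r.
by rewrite -mulrDr invfM; move: (u + v)^-1 => w; field.
Qed.

(* [u] and [v] are the likelihoods of the transcript under the two laws. *)
Lemma two_point_risk_ge p q k d F G
    (p01 : forall a, 0 <= p a <= 1) (pq : forall a, a != k -> p a = q a)
    (pk : p k = 2^-1 + d) (qk : q k = 2^-1 - d) (d01 : 0 <= d < 2^-1)
    (F0 : forall tr, 0 <= F tr) (G0 : forall tr, 0 <= G tr)
    (FG : forall tr, 1 <= F tr + G tr) m tr u v : 0 <= u -> 0 <= v ->
  4 * (u * v / (u + v)) - 9 / 16 * (u + v)
    - 4 * d ^+ 2 * (u * request_mean p k m tr + v * request_mean q k m tr)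
  <= u * tree_mean p F m tr + v * tree_mean q G m tr.
Proof.
elim: m tr u v => [|m IH] tr u v u0 v0 /=.
  by rewrite !mulr0 addr0 mulr0 subr0; exact: bayes_risk_ge.
case: (req tr) => [a|]; last first.
  by rewrite !mulr0 addr0 mulr0 subr0; exact: bayes_risk_ge.
(* A request of [k] raises both request counts by one; the resulting [4 d^2 (u + v)] is exactly 4
   times the loss in [harmonic_step]. *)
have [->|ak] := eqVneq a k.
  have /andP[d0 d1] := d01.
  have a0 : 0 <= 2^-1 + d by rewrite addr_ge0 ?invr_ge0.
  have b0 : 0 <= 2^-1 - d by rewrite subr_ge0 ltW.
  have := harmonic_step u0 v0 d01 => /=.
  have := IH (rcons tr (k, true)) ((2^-1 + d) * u) ((2^-1 - d) * v)
             (mulr_ge0 a0 u0) (mulr_ge0 b0 v0).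
  have := IH (rcons tr (k, false)) ((2^-1 - d) * u) ((2^-1 + d) * v)
             (mulr_ge0 b0 u0) (mulr_ge0 a0 v0).
  rewrite pk qk mulr1n.
  set h1 := (_ / _); set h2 := (_ / _); set h3 := (_ / _).
  lra.
have /andP[a0 a1] := p01 a.
have b0 : 0 <= 1 - p a by rewrite subr_ge0.
have := IH (rcons tr (a, true)) (p a * u) (p a * v)
           (mulr_ge0 a0 u0) (mulr_ge0 a0 v0).
have := IH (rcons tr (a, false)) ((1 - p a) * u) ((1 - p a) * v)
           (mulr_ge0 b0 u0) (mulr_ge0 b0 v0).
rewrite -pq// !harmonicZ mulr0n.
set h := (_ / _).
lra.
Qed.

End SequentialExperiment.

(* No measurability is assumed below: the library integral of a nonnegative
   function is a supremum over simple minorants, hence a lower integral. *)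
Section LowerIntegral.
Local Open Scope ereal_scope.
Context d (X : measurableType d) (R : realType).
Variable mu : {measure set X -> \bar R}.
Import HBNNSimple.
Implicit Types f g : X -> \bar R.

Lemma lower_integral_le f g : (forall x, 0 <= f x) ->
  (forall x, f x <= g x) -> \int[mu]_x f x <= \int[mu]_x g x.
Proof.
move=> f0 fg; have g0 x : 0 <= g x by exact: le_trans (fg x).
rewrite !ge0_integralTE//; apply: ereal_sup_le => _ [h /= hf <-].
by exists h => // x; exact: le_trans (fg x).
Qed.

(** Simple minorants of [f] and of [g] add up to a simple minorant of the sum; the supremum is taken
    over one, then over the other. An infinite [C] is set aside first, because terms are moved
    across by subtraction. *)
Lemma lower_integral_superadditive f g : (forall x, 0 <= f x) ->
  (forall x, 0 <= g x) ->
  \int[mu]_x f x + \int[mu]_x g x <= \int[mu]_x (f x + g x).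
Proof.
move=> f0 g0; have fg0 x : 0 <= f x + g x by exact: adde_ge0.
have : 0 <= \int[mu]_x (f x + g x) by exact: integral_ge0.
rewrite !ge0_integralTE//.
set C := ereal_sup _ => C0.
have hC (h1 h2 : {nnsfun X >-> R}) : (forall x, (h1 x)%:E <= f x) ->
    (forall x, (h2 x)%:E <= g x) -> sintegral mu h1 + sintegral mu h2 <= C.
  move=> h1f h2g; rewrite -sintegralD//.
  apply: ereal_sup_ubound; exists (add_nnsfun h1 h2) => // x /=.
  by rewrite EFinD leeD.
have [->|Cfin] := eqVneq C +oo; first by rewrite leey.
have {}Cfin : C \is a fin_num by rewrite ge0_fin_numE// lt_neqAle Cfin leey.
rewrite -lee_suber_addr//; apply: ge_ereal_sup => _ [h1 /= h1f <-].
rewrite lee_suber_addr// -lee_suber_addl//.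
apply: ge_ereal_sup => _ [h2 /= h2g <-].
by rewrite lee_suber_addl//; exact: hC.
Qed.

Lemma lower_integral_sum (J : Type) (r : seq J) (D : pred J)
    (f : J -> X -> \bar R) : (forall j x, 0 <= f j x) ->
  \sum_(j <- r | D j) \int[mu]_x f j x
    <= \int[mu]_x \sum_(j <- r | D j) f j x.
Proof.
move=> f0; elim: r => [|j r IH].
  by rewrite big_nil integral_ge0// => x _; rewrite big_nil.
rewrite big_cons; under [leRHS]eq_integral do rewrite big_cons.
case: (D j) => //; apply: le_trans (lower_integral_superadditive _ _) => //.
  by rewrite leeD2l.
by move=> x; exact: sume_ge0.
Qed.

End LowerIntegral.

Import HBNNSimple.
(** A simple minorant integrates to its value at [a]. This inequality suffices to bound the cost of
    a deterministic policy from above. *)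
Lemma lower_integral_dirac_le d (X : measurableType d) (R : realType) (a : X)
    (f : X -> \bar R) : (forall x, 0 <= f x)%E ->
  (\int[\d_a]_x f x <= f a)%E.
Proof.
move=> f0; rewrite ge0_integralTE//; apply: ge_ereal_sup => _ [h /= hf <-].
have := integral_nnsfun (\d_a) measurableT h.
rewrite patch_setT => <-.
rewrite integral_dirac ?diracT ?mul1e//.
exact: measurableT_comp.
Qed.

(** * Policies *)

Definition bernoulli_laws (R : realType) (q : nat -> R) : demand_laws R :=
  fun t => bernoulli_prob (q t).

(** Measurability into tuples is tested by coordinates: the first [t] are inherited, the last is the
    new triple. *)
Lemma measurable_extend (R : realType) (t : nat) (b : bool) :
  measurable_fun [set: history R t * measurableTypeR R]
    (fun z => extend z.1 z.2 b).
Proof.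
apply: measurable_fun_pair => /=; last first.
  by apply: measurable_funB => //; exact: measurable_cst.
apply/measurable_fun_tnthP => i.
have [it|ti] := ltnP i t.
  rewrite (_ : _ \o _ = fun z : history R t * measurableTypeR R =>
                          tnth z.1.1 (Ordinal it)).
    apply: (measurableT_comp (measurable_tnth (Ordinal it))).
    exact: measurableT_comp.
  by apply/funext => z /=; rewrite !(tnth_nth point)/= nth_rcons size_tuple it.
have it : i = t :> nat by apply/eqP; rewrite eqn_leq ti -ltnS ltn_ord.
rewrite (_ : _ \o _ = fun z : history R t * measurableTypeR R =>
                        (z.1.2, z.2, b)).
  apply: measurable_fun_pair => //; apply: measurable_fun_pair => //.
  exact: measurableT_comp.
apply/funext => z /=.
by rewrite (tnth_nth point)/= nth_rcons size_tuple it ltnn eqxx.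
Qed.

(** * Expectations of functions of one chosen level, and lower bounds on the cost *)

Section ExpectedActions.
Local Open Scope ereal_scope.
Context (R : realType) (r : level_rule).
Implicit Types (P : demand_laws R) (pi : policy R r) (g : R -> \bar R).

(** Conditional expectation of [g] at the level chosen in period [t + j], given the history at
    period [t]. The recursion stops before the demand of period [t + j] is drawn. *)
Fixpoint mean_action P pi g (j t : nat) (hs : history R t) : \bar R :=
  if j is j'.+1 then
    \int[action_law pi t hs]_y \int[P t]_d
      mean_action P pi g j' (extend hs y d)
  else \int[action_law pi t hs]_y g y.

Lemma mean_action_ge0 P pi g j t (hs : history R t) :
  (forall y, 0 <= g y) -> 0 <= mean_action P pi g j hs.
Proof.
move=> g0; elim: j t hs => [|j IH] t hs /=; apply: integral_ge0 => // y _.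
by apply: integral_ge0 => b _; exact: IH.
Qed.

Lemma mean_action_le P pi g1 g2 j t (hs : history R t) :
  (forall y, 0 <= g1 y) -> (forall y, g1 y <= g2 y) ->
  mean_action P pi g1 j hs <= mean_action P pi g2 j hs.
Proof.
move=> g10 g12.
elim: j t hs => [|j IH] t hs /=; apply: lower_integral_le => // y.
  by apply: integral_ge0 => b _; exact: mean_action_ge0.
by apply: lower_integral_le => // b; exact: mean_action_ge0.
Qed.

Lemma eq_mean_action P1 P2 pi g j t (hs : history R t) :
  (forall s, (t <= s < t + j)%N -> P1 s = P2 s) ->
  mean_action P1 pi g j hs = mean_action P2 pi g j hs.
Proof.
elim: j t hs => [|j IH] t hs P12 //=.
apply: eq_integral => y _.
rewrite (P12 t); last by rewrite leqnn addnS ltnS leq_addr.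
apply: eq_integral => b _; apply: IH => s /andP[ts sj]; apply: P12.
by rewrite (ltnW ts) addnS -addSn.
Qed.

Section BernoulliDemand.
Variables (q : nat -> R) (q01 : forall t, (0 <= q t <= 1)%R).
Variable pi : policy R r.
Notation P := (bernoulli_laws q).

Lemma integral_bernoulli_laws t (f : bool -> \bar R) : (forall b, 0 <= f b) ->
  \int[P t]_b f b = (q t)%:E * f true + (1 - q t)%:E * f false.
Proof. by move=> f0; rewrite integral_bernoulli_prob. Qed.

Lemma measurable_demand_step t (F : history R t.+1 -> \bar R) :
  (forall hs, 0 <= F hs) -> measurable_fun setT F ->
  measurable_fun [set: history R t * measurableTypeR R]
    (fun z => \int[P t]_b F (extend z.1 z.2 b)).
Proof.
move=> F0 mF.
rewrite (_ : (fun z => _) = fun z => (q t)%:E * F (extend z.1 z.2 true)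
                               + (1 - q t)%:E * F (extend z.1 z.2 false)).
  apply: emeasurable_funD; apply: emeasurable_funM => //;
    by apply: (measurableT_comp mF); exact: measurable_extend.
by apply/funext => z; exact: integral_bernoulli_laws.
Qed.

Lemma measurable_mean_action g j t : (forall y, 0 <= g y) ->
  measurable_fun [set: measurableTypeR R] g ->
  measurable_fun [set: history R t] (mean_action P pi g j (t := t)).
Proof.
move=> g0 mg; elim: j t => [|j IH] t /=.
  apply: measurable_fun_integral_kernel => // U mU.
  exact: measurable_kernel.
apply: (measurable_fun_integral_finite_kernel
  (fun z : history R t * measurableTypeR R =>
     \int[P t]_d mean_action P pi g j (extend z.1 z.2 d)) (action_law pi t)).
  by move=> z; apply: integral_ge0 => b _; exact: mean_action_ge0.
by apply: measurable_demand_step => // hs; exact: mean_action_ge0.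
Qed.

Lemma measurable_mean_action_step g j t (hs : history R t) :
  (forall y, 0 <= g y) -> measurable_fun [set: measurableTypeR R] g ->
  measurable_fun [set: measurableTypeR R]
    (fun y => \int[P t]_b mean_action P pi g j (extend hs y b)).
Proof.
move=> g0 mg.
have h := measurable_demand_step (fun hs => mean_action_ge0 P pi j hs g0)
  (@measurable_mean_action g j t.+1 g0 mg).
exact: (measurableT_comp h (measurable_pair1 hs)).
Qed.

Lemma mean_action_cst (a : R) j t (hs : history R t) : (0 <= a)%R ->
  mean_action P pi (fun=> a%:E) j hs = a%:E.
Proof.
move=> a0; elim: j t hs => [|j IH] t hs /=.
  by rewrite integral_cst//= prob_kernel mule1.
under eq_integral => y _.
  under eq_integral do rewrite IH.
  by rewrite integral_cst//= probability_setT mule1; over.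
by rewrite integral_cst//= prob_kernel mule1.
Qed.

Lemma mean_actionD g1 g2 j t (hs : history R t) :
  (forall y, 0 <= g1 y) -> measurable_fun [set: measurableTypeR R] g1 ->
  (forall y, 0 <= g2 y) -> measurable_fun [set: measurableTypeR R] g2 ->
  mean_action P pi (fun y => g1 y + g2 y) j hs
    = mean_action P pi g1 j hs + mean_action P pi g2 j hs.
Proof.
move=> g10 mg1 g20 mg2; elim: j t hs => [|j IH] t hs /=.
  by rewrite ge0_integralD.
rewrite -ge0_integralD//; try exact: measurable_mean_action_step;
  try by move=> y _; apply: integral_ge0 => b _; exact: mean_action_ge0.
apply: eq_integral => y _; rewrite -ge0_integralD//;
  try by move=> b _; exact: mean_action_ge0.
by apply: eq_integral => b _.
Qed.

Lemma mean_actionZ (k : R) g j t (hs : history R t) : (0 <= k)%R ->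
  (forall y, 0 <= g y) -> measurable_fun [set: measurableTypeR R] g ->
  mean_action P pi (fun y => k%:E * g y) j hs
    = k%:E * mean_action P pi g j hs.
Proof.
move=> k0 g0 mg; elim: j t hs => [|j IH] t hs /=.
  by rewrite ge0_integralZl_EFin.
rewrite -ge0_integralZl_EFin//; try exact: measurable_mean_action_step;
  try by move=> y _; apply: integral_ge0 => b _; exact: mean_action_ge0.
apply: eq_integral => y _; rewrite -ge0_integralZl_EFin//;
  try by move=> b _; exact: mean_action_ge0.
by apply: eq_integral => b _.
Qed.

Lemma period_cost_ge0 (h p y x : R) : (0 <= h)%R -> (0 <= p)%R ->
  (0 <= period_cost h p y x)%R.
Proof.
by move=> h0 p0; rewrite addr_ge0// mulr_ge0// /pos_part le_max lexx orbT.
Qed.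

Lemma cost_to_go_ge0 (hc pc : nat -> R) (Q : demand_laws R) n t
    (hs : history R t) :
  (forall s, 0 <= hc s)%R -> (forall s, 0 <= pc s)%R ->
  0 <= cost_to_go hc pc Q pi n hs.
Proof.
move=> h0 p0; elim: n t hs => [|n IH] t hs //=.
apply: integral_ge0 => y _; apply: integral_ge0 => b _.
by rewrite adde_ge0// lee_fin period_cost_ge0.
Qed.

(** Given its level, period [s] has expected cost at least [psi s]; the bounds of the later periods
    are collected by superadditivity of the lower integral. *)
Lemma cost_to_go_ge (hc pc : nat -> R) (psi : nat -> R -> R) n t
    (hs : history R t) :
  (forall s, 0 <= hc s)%R -> (forall s, 0 <= pc s)%R ->
  (forall s y, 0 <= psi s y)%R ->
  (forall s y, psi s y <= q s * period_cost (hc s) (pc s) y 1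
                     + (1 - q s) * period_cost (hc s) (pc s) y 0)%R ->
  \sum_(0 <= j < n) mean_action P pi (fun y => (psi (t + j)%N y)%:E) j hs
    <= cost_to_go hc pc P pi n hs.
Proof.
move=> h0 p0 psi0 psile; elim: n t hs => [|n IH] t hs.
  by rewrite big_geq.
rewrite big_nat_recl//= addn0.
have m0 s j t' (hs' : history R t') :
    0 <= mean_action P pi (fun y => (psi (s + j)%N y)%:E) j hs'.
  by apply: mean_action_ge0 => y'; rewrite lee_fin.
(* The intermediate term separates the bound for period [t] from the tail, whose sum has been moved
   under both integrals. *)
apply: (@le_trans _ _ (\int[action_law pi t hs]_y ((psi t y)%:E +
  \int[P t]_b \sum_(0 <= j < n)
    mean_action P pi (fun y => (psi (t.+1 + j)%N y)%:E) j (extend hs y b)))).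
  apply: le_trans (lower_integral_superadditive _ _ _) => //; last first.
  - by move=> y; apply: integral_ge0 => b _; apply: sume_ge0 => i _; exact: m0.
  - by move=> y; rewrite lee_fin.
  apply: leeD => //.
  under [leLHS]eq_bigr do rewrite addnS -addSn.
  apply: le_trans; first apply: lower_integral_sum.
    by move=> j y; apply: integral_ge0 => b _; exact: m0.
  apply: lower_integral_le => y.
    by apply: sume_ge0 => j _; apply: integral_ge0 => b _; exact: m0.
  by apply: lower_integral_sum => j b; exact: m0.
apply: lower_integral_le => y.
  rewrite adde_ge0 ?lee_fin//.
  by apply: integral_ge0 => b _; apply: sume_ge0 => i _; exact: m0.
have pc0 b : (0 <= period_cost (hc t) (pc t) y b%:R)%R.
  exact: period_cost_ge0.
(* Every function on [bool] is measurable, so the demand integral is additive. *)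
rewrite ge0_integralD//; last first.
- by move=> b _; exact: cost_to_go_ge0.
- by move=> b _; rewrite lee_fin.
apply: leeD; last first.
  apply: lower_integral_le => b //.
  by apply: sume_ge0 => i _; exact: m0.
rewrite integral_bernoulli_laws/=; last by move=> b; rewrite lee_fin.
by rewrite -!EFinM -EFinD lee_fin.
Qed.

End BernoulliDemand.
End ExpectedActions.

(** * The hidden-sign instances *)

Section LevelPolicy.
Context (R : realType) (r : level_rule) (b : nat -> R).
Hypothesis b0 : forall t, 0 <= b t.

(** Base-stock decision with target [b t]. Nonnegative targets make it feasible under either action
    rule. *)
Let level t (hs : history R t) : measurableTypeR R := Num.max hs.2 (b t).

Let measurable_level t : measurable_fun setT (@level t).
Proof. by apply: measurable_maxr => //; exact: measurable_cst. Qed.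

Let level_feasible t (hs : history R t) :
  kdirac (R := R) (@measurable_level t) hs
    [set y : R | min_level r hs.2 <= y] = 1%E.
Proof.
rewrite /kdirac/= diracE mem_set//= /level.
case: r => /=; last by rewrite le_max lexx.
by rewrite ge_max !le_max lexx b0 orbT.
Qed.

Definition level_policy : policy R r :=
  @Policy R r (fun t => kdirac (R := R) (@measurable_level t)) level_feasible.

Lemma level_policy_cost_le (hc pc q : nat -> R) n t (hs : history R t) :
  (forall s, 0 <= hc s) -> (forall s, 0 <= pc s) ->
  (forall s, 0 <= q s <= 1) ->
  let y := Num.max hs.2 (b t) in
  let cost (d : bool) := ((period_cost (hc t) (pc t) y d%:R)%:E
    + cost_to_go hc pc (bernoulli_laws q) level_policy n (extend hs y d))%E in
  (cost_to_go hc pc (bernoulli_laws q) level_policy n.+1 hs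
    <= (q t)%:E * cost true + (1 - q t)%:E * cost false)%E.
Proof.
move=> h0 p0 q01; cbv zeta; set y := Num.max _ _.
have c0 z (d : bool) : (0 <= (period_cost (hc t) (pc t) z d%:R)%:E
    + cost_to_go hc pc (bernoulli_laws q) level_policy n (extend hs z d))%E.
  by rewrite adde_ge0 ?cost_to_go_ge0// lee_fin period_cost_ge0.
apply: (@le_trans _ _ (\int[bernoulli_laws q t]_d
    ((period_cost (hc t) (pc t) y d%:R)%:E
     + cost_to_go hc pc (bernoulli_laws q) level_policy n (extend hs y d)))%E).
  apply: (@lower_integral_dirac_le _ (measurableTypeR R) R y (fun z =>
    \int[bernoulli_laws q t]_d ((period_cost (hc t) (pc t) z d%:R)%:E
     + cost_to_go hc pc (bernoulli_laws q) level_policy n (extend hs z d)))%E).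
  by move=> z; apply: integral_ge0 => d _; exact: c0.
by rewrite integral_bernoulli_laws.
Qed.

End LevelPolicy.

(** * Costs and misses under hidden signs *)

Definition hidden_bias (R : realType) (d : R) (sg : nat -> bool) (t : nat) :
    R :=
  if odd t then 1 else if sg t then 2^-1 + d else 2^-1 - d.

(** Distance from the preferred level, 1 or 0, after clipping [y] to the unit interval. Clipping
    makes the two misses sum to 1 at every level, negative ones included. *)
Definition miss (R : realType) (b : bool) (y : R) : R :=
  let c := Num.max 0 (Num.min y 1) in if b then 1 - c else c.

Section Instance.
Context (R : realType) (r : level_rule) (d : R).
Hypothesis d01 : 0 <= d < 2^-1.
Implicit Types (sg : nat -> bool) (pi : policy R r) (y : R).

Lemma hidden_bias01 sg t : 0 <= hidden_bias d sg t <= 1.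
Proof.
have /andP[d0 d1] := d01; rewrite /hidden_bias.
by case: ifP => _; [|case: ifP => _]; apply/andP; split; lra.
Qed.

Lemma miss_ge0 b y : 0 <= miss b y.
Proof.
rewrite /miss; case: b; last by rewrite le_max lexx.
by rewrite subr_ge0 ge_max ler01 ge_min lexx orbT.
Qed.

Lemma miss_negb b y : miss b y + miss (~~ b) y = 1.
Proof. by case: b; rewrite /miss /= ?subrK// addrC subrK. Qed.

Lemma measurable_miss b : measurable_fun [set: measurableTypeR R] (@miss R b).
Proof.
have mc : measurable_fun [set: measurableTypeR R]
    (fun y : R => Num.max 0 (Num.min y 1)).
  apply: measurable_maxr; first exact: measurable_cst.
  by apply: measurable_minr => //; exact: measurable_cst.
by case: b => //; apply: measurable_funB => //; exact: measurable_cst.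
Qed.

Definition cost_lower_bound sg t y : R :=
  if odd t then 0 else 2^-1 - d + 2 * d * miss (sg t) y.

Lemma cost_lower_bound_ge0 sg t y : 0 <= cost_lower_bound sg t y.
Proof.
have /andP[d0 d1] := d01; rewrite /cost_lower_bound; case: ifP => // _.
have := mulr_ge0 d0 (miss_ge0 (sg t) y); lra.
Qed.

(** In an even period the expected cost is affine on the unit interval and equals the bound there;
    outside, the cost only grows while [miss] stays constant. *)
Lemma cost_lower_boundP sg t y :
  cost_lower_bound sg t y <= hidden_bias d sg t * period_cost 1 1 y 1
                       + (1 - hidden_bias d sg t) * period_cost 1 1 y 0.
Proof.
have /andP[d0 d1] := d01.
rewrite /cost_lower_bound /hidden_bias; case: ifP => _.
  by rewrite subrr mul0r addr0 mul1r period_cost_ge0.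
rewrite /period_cost /pos_part /miss !mul1r subr0 sub0r.
have [y0|y0] := leP y 0.
  rewrite (min_l (le_trans y0 ler01)) (max_l y0) (max_r (y := 0)); last lra.
  rewrite (max_l (x := 1 - y)); last lra.
  rewrite (max_l (x := - y)); last lra.
  case: (sg t); nra.
rewrite (max_r (x := - y)); last lra.
have [y1|y1] := leP y 1.
  rewrite (max_r (ltW y0)) (max_r (x := y - 1)); last lra.
  rewrite (max_l (x := 1 - y)); last lra.
  case: (sg t); nra.
rewrite (max_r ler01) (max_l (x := y - 1)); last lra.
rewrite (max_r (x := 1 - y)); last lra.
case: (sg t); nra.
Qed.

Definition start : history R 0 := ([tuple], 0).

Definition mean_miss sg pi t : R :=
  fine (mean_action (bernoulli_laws (hidden_bias d sg)) pi
          (fun y => (miss (sg t) y)%:E) t start).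

Lemma mean_missE sg pi t :
  mean_action (bernoulli_laws (hidden_bias d sg)) pi
    (fun y => (miss (sg t) y)%:E) t start = (mean_miss sg pi t)%:E.
Proof.
rewrite /mean_miss fineK// ge0_fin_numE; last first.
  by apply: mean_action_ge0 => y; rewrite lee_fin miss_ge0.
apply: le_lt_trans (ltry 1).
rewrite -(@mean_action_cst _ _ (hidden_bias d sg) pi 1 t 0 start ler01).
apply: mean_action_le => y; rewrite lee_fin ?miss_ge0//.
by rewrite -(miss_negb (sg t) y) lerDl miss_ge0.
Qed.

Lemma mean_miss_ge0 sg pi t : 0 <= mean_miss sg pi t.
Proof.
by rewrite fine_ge0// mean_action_ge0// => y; rewrite lee_fin miss_ge0.
Qed.

(* The level chosen in period [t] is independent of the law of that period. *)
Lemma mean_miss_flip sg1 sg2 pi t : (forall s, (s < t)%N -> sg1 s = sg2 s) ->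
  sg2 t = ~~ sg1 t -> mean_miss sg1 pi t + mean_miss sg2 pi t = 1.
Proof.
move=> sg12 sg2t; apply: EFin_inj; rewrite EFinD -!mean_missE sg2t.
rewrite -(@eq_mean_action _ _ (bernoulli_laws (hidden_bias d sg1))); last first.
  move=> s; rewrite add0n => /andP[_ st].
  by rewrite /bernoulli_laws /hidden_bias sg12.
have m0 b y : (0 <= (miss b y)%:E)%E by rewrite lee_fin miss_ge0.
have mm b : measurable_fun [set: measurableTypeR R] (fun y => (miss b y)%:E).
  by apply: measurableT_comp => //; exact: measurable_miss.
rewrite -mean_actionD//; last exact: hidden_bias01.
rewrite -[RHS](@mean_action_cst _ _ (hidden_bias d sg1) pi 1 t 0 start ler01).
rewrite [X in mean_action _ _ X _ _ = _](_ : _ = fun=> 1%E)//.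
by apply/funext => y; rewrite -EFinD miss_negb.
Qed.

Lemma mean_miss_le1 sg pi t : mean_miss sg pi t <= 1.
Proof.
(* The second sequence agrees with [sg] before [t] and takes the opposite of [sg t] from [t] on, so
   the two mean misses sum to 1. *)
rewrite -(@mean_miss_flip sg
  (fun s => if (s < t)%N then sg s else ~~ sg t) pi t).
- by rewrite lerDl mean_miss_ge0.
- by move=> s ->.
- by rewrite ltnn.
Qed.

Lemma mean_cost_lower_bound sg pi t :
  mean_action (bernoulli_laws (hidden_bias d sg)) pi
    (fun y => (cost_lower_bound sg t y)%:E) t start
  = (if odd t then 0 else 2^-1 - d + 2 * d * mean_miss sg pi t)%:E.
Proof.
have /andP[d0 d1] := d01.
rewrite /cost_lower_bound; case: ifP => _; first exact: mean_action_cst.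
have mm : measurable_fun [set: measurableTypeR R] (fun y => (miss (sg t) y)%:E).
  by apply: measurableT_comp => //; exact: measurable_miss.
have d20 : 0 <= 2 * d by rewrite mulr_ge0.
rewrite EFinD EFinM -mean_missE -mean_actionZ//; last 2 first.
- exact: hidden_bias01.
- by move=> y; rewrite lee_fin miss_ge0.
have dd : 0 <= 2^-1 - d by rewrite subr_ge0 ltW.
rewrite -[X in (X + _)%E]
  (@mean_action_cst _ _ (hidden_bias d sg) pi _ t 0 start dd).
rewrite -mean_actionD//.
- exact: hidden_bias01.
- by move=> y; rewrite mule_ge0// lee_fin// miss_ge0.
- exact: measurable_funeM.
Qed.

Lemma policy_value_ge sg pi T :
  ((\sum_(t < T | ~~ odd t) (2^-1 - d + 2 * d * mean_miss sg pi t))%:E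
  <= policy_value T (fun=> 1%R) (fun=> 1%R)
       (bernoulli_laws (hidden_bias d sg)) 0%R pi)%E.
Proof.
have := @cost_to_go_ge _ _ _ (hidden_bias01 sg) pi (fun=> 1) (fun=> 1)
  (cost_lower_bound sg) T 0 start (fun=> ler01) (fun=> ler01)
  (cost_lower_bound_ge0 sg) (cost_lower_boundP sg).
apply: le_trans; rewrite -sumEFin big_mkord big_mkcond/=.
apply: lee_sum => t _; rewrite add0n mean_cost_lower_bound.
by case: (odd t).
Qed.

(** Targets of the reference policy: the demand favoured by the sign in even periods, and 1 in odd
    ones. *)
Lemma hidden_target_ge0 sg t : 0 <= (odd t || sg t)%:R :> R.
Proof. exact: ler0n. Qed.

(** Induction over pairs of periods: in an even period the demand differs from the target with
    probability [1/2 - d], at cost 1. *)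
Lemma hidden_policy_cost_le sg n t (hs : history R t) : ~~ odd t -> hs.2 = 0 ->
  (cost_to_go (fun=> 1%R) (fun=> 1%R) (bernoulli_laws (hidden_bias d sg))
     (level_policy r (hidden_target_ge0 sg)) n.*2 hs
   <= (n%:R * (2^-1 - d))%:E)%E.
Proof.
have /andP[d0 d1] := d01.
have h0 (s : nat) : 0 <= 1 :> R by [].
elim: n t hs => [|n IH] t hs todd hs0; first by rewrite mul0r.
(* From inventory at most 1, the odd period orders up to 1; its demand 1 costs nothing and brings
   the inventory back to 0. *)
have odd_step (hs' : history R t.+1) : hs'.2 <= 1 ->
    (cost_to_go (fun=> 1%R) (fun=> 1%R) (bernoulli_laws (hidden_bias d sg))
     (level_policy r (hidden_target_ge0 sg)) n.*2.+1 hs'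
    <= (n%:R * (2^-1 - d))%:E)%E.
  move=> hs1; apply: le_trans.
    by apply: level_policy_cost_le => // s; exact: hidden_bias01.
  rewrite /= /hidden_bias/= todd/= subrr mul0e adde0 mul1e.
  rewrite (max_r hs1) /period_cost /pos_part subrr maxxx !mulr0 add0r add0e.
  by apply: IH; rewrite /= ?negbK// subrr.
rewrite doubleS; apply: le_trans.
  by apply: level_policy_cost_le => // s; exact: hidden_bias01.
cbv beta; rewrite hs0 (max_r (hidden_target_ge0 sg t)) (negbTE todd) orFb.
have /andP[q0 q1] := hidden_bias01 sg t.
apply: (@le_trans _ _
  ((hidden_bias d sg t)%:E
     * (period_cost 1 1 (sg t)%:R 1 + n%:R * (2^-1 - d))%:E
   + (1 - hidden_bias d sg t)%:E
     * (period_cost 1 1 (sg t)%:R 0 + n%:R * (2^-1 - d))%:E)%E).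
  by apply: leeD; apply: lee_wpmul2l; rewrite ?lee_fin ?subr_ge0// [leRHS]EFinD;
    apply: leeD => //; apply: odd_step;
    rewrite /= lerBlDr (le_trans (y := 1)) ?lern1 ?leq_b1// lerDl ler0n.
rewrite -!EFinM -EFinD lee_fin -natr1 /hidden_bias (negbTE todd).
rewrite /period_cost /pos_part.
rewrite le_eqVlt; apply/orP; left; apply/eqP.
by case: (sg t); rewrite ?mulr1n ?mulr0n ?subrr ?subr0 ?sub0r maxxx
  (max_l ler01) (max_r (lerN10 R)); field.
Qed.

Lemma optimal_value_le sg K :
  (optimal_value r K.*2 (fun=> 1%R) (fun=> 1%R)
     (bernoulli_laws (hidden_bias d sg)) 0%R <= (K%:R * (2^-1 - d))%:E)%E.
Proof.
apply: le_trans (@hidden_policy_cost_le sg K 0 start isT erefl).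
by apply: ereal_inf_lbound; exists (level_policy r (hidden_target_ge0 sg)).
Qed.

Lemma optimal_value_ge0 sg T :
  (0 <= optimal_value r T (fun=> 1%R) (fun=> 1%R)
     (bernoulli_laws (hidden_bias d sg)) 0%R)%E.
Proof. by apply: le_ereal_inf_tmp => _ [pi _ <-]; exact: cost_to_go_ge0. Qed.

Lemma sum_even_ord (V : nmodType) (a : V) K :
  \sum_(t < K.*2 | ~~ odd t) a = a *+ K.
Proof.
rewrite big_mkcond/=; elim: K => [|K IH]; first by rewrite big_ord0.
by rewrite doubleS !big_ord_recr/= IH odd_double/= addr0 mulrSr.
Qed.

(** The term [K (1/2 - d)] bounds the optimal value and is also the miss-free part of
    [policy_value_ge]; it cancels and leaves the excess cost. *)
Lemma eps_optimal_mean_miss_le sg pi K eps :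
  eps_optimal K.*2 (fun=> 1%R) (fun=> 1%R)
    (bernoulli_laws (hidden_bias d sg)) 0%R eps pi ->
  2 * d * \sum_(t < K.*2 | ~~ odd t) mean_miss sg pi t <= eps.
Proof.
(* Moving the optimal value across in the extended reals requires its finiteness. *)
rewrite /eps_optimal/= leeBlDr; last first.
  rewrite ge0_fin_numE ?optimal_value_ge0//.
  exact: le_lt_trans (optimal_value_le sg K) (ltry _).
move=> /(le_trans (policy_value_ge sg pi K.*2)) h.
have := le_trans h (leeD2l _ (optimal_value_le sg K)).
rewrite -EFinD lee_fin big_split/= sum_even_ord -mulr_sumr -mulr_natl.
lra.
Qed.

End Instance.

(** * Averaging over the signs *)

Section Assouad.
Context (I : finType).
Implicit Types (s : {ffun I -> bool}) (k : I).

Definition flip_sign k s : {ffun I -> bool} :=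
  [ffun i => if i == k then ~~ s i else s i].

Lemma flip_signK k : involutive (flip_sign k).
Proof.
by move=> s; apply/ffunP => i; rewrite !ffunE; case: eqP => // _; rewrite negbK.
Qed.

(** Flipping [k] is an involution, so summing the paired inequality over all signs counts every term
    twice. This is the averaging step of Assouad's argument. *)
Lemma sum_ge_flip (R : realFieldType) k (x y : {ffun I -> bool} -> R) :
  (forall s, x s + x (flip_sign k s) <= y s + y (flip_sign k s)) ->
  \sum_s x s <= \sum_s y s.
Proof.
move=> xy; have dbl (z : {ffun I -> bool} -> R) :
    \sum_s (z s + z (flip_sign k s)) = 2 * \sum_s z s.
  rewrite mulr_natl mulr2n big_split/=; congr (_ + _).
  by rewrite [RHS](reindex_inj (inv_inj (flip_signK k))).
have : \sum_s (x s + x (flip_sign k s)) <= \sum_s (y s + y (flip_sign k s)).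
  exact: ler_sum.
by rewrite !dbl ler_pM2l.
Qed.

End Assouad.

(** Laws are indexed by all of [nat], hence the default [false] beyond the horizon. *)
Definition sign_seq (n : nat) (s : {ffun 'I_n -> bool}) (t : nat) : bool :=
  oapp s false (insub t).

Lemma sign_seqE n (s : {ffun 'I_n -> bool}) (t : 'I_n) : sign_seq s t = s t.
Proof. by rewrite /sign_seq valK. Qed.

Lemma sign_seq_flip n (s : {ffun 'I_n -> bool}) (k : 'I_n) (t : nat) :
  t != k ->
  sign_seq (flip_sign k s) t = sign_seq s t.
Proof.
move=> tk; rewrite /sign_seq; case: insubP => //= i _ it.
by rewrite ffunE ifN// -val_eqE/= it.
Qed.

Lemma return_prob_ge0 (R : realType) (r : level_rule) (T : nat)
    (dW : measure_display) (W : measurableType dW) (A : algorithm R r T W)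
    (P : demand_laws R) (G : set (policy R r)) w m tr :
  (0 <= return_prob A P G w m tr)%E.
Proof.
elim: m tr => [|m IH] tr /=; first by rewrite lee_fin.
case: request => [a|]; last by rewrite lee_fin.
by apply: integral_ge0 => b _.
Qed.

Lemma return_probE (R : realType) (r : level_rule) (T : nat)
    (dW : measure_display) (W : measurableType dW) (A : algorithm R r T W)
    (q : nat -> R) (q01 : forall t, 0 <= q t <= 1) (G : set (policy R r))
    w m tr :
  return_prob A (bernoulli_laws q) G w m tr
  = (tree_mean (request A w) (fun a : 'I_T => q a)
       (fun x => \1_G (returned A w x)) m tr)%:E.
Proof.
elim: m tr => [|m IH] tr //=.
case: request => [a|//].
rewrite integral_bernoulli_laws//; last by move=> b; exact: return_prob_ge0.
by rewrite !IH.
Qed.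

(** * Bayes risk of an algorithm whose seed is fixed *)

Section Risk.
Context (R : realType) (r : level_rule) (K : nat) (eps d : R).
Hypothesis K0 : (0 < K)%N.
Hypothesis eps0 : 0 < eps.
Hypothesis dE : d = 4 * eps / K%:R.
Hypothesis d01 : 0 <= d < 2^-1.
Variable req : transcript K.*2 -> option 'I_K.*2.
Variable ret : transcript K.*2 -> policy R r.
Variable M : nat.
Implicit Types (s : {ffun 'I_K.*2 -> bool}) (k : 'I_K.*2).

Definition sign_bias s (t : 'I_K.*2) : R := hidden_bias d (sign_seq s) t.

Lemma sign_bias01 s t : 0 <= sign_bias s t <= 1.
Proof. exact: hidden_bias01. Qed.

Definition risk s k : R :=
  tree_mean req (sign_bias s)
    (fun tr => mean_miss d (sign_seq s) (ret tr) k) M [::].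

Definition queries s k : R := request_mean req (sign_bias s) k M [::].

Definition success s : R := tree_mean req (sign_bias s)
  (fun tr => \1_(eps_optimal K.*2
  (fun=> 1%R) (fun=> 1%R) (bernoulli_laws (hidden_bias d (sign_seq s))) 0%R eps)
  (ret tr)) M [::].

Lemma risk_flip_ge s k : ~~ odd k ->
  7 / 8 - 4 * d ^+ 2 * (queries s k + queries (flip_sign k s) k)
    <= risk s k + risk (flip_sign k s) k.
Proof.
move=> kodd.
wlog sk : s / s k.
  move=> H; have [sk|sk] := boolP (s k); first exact: H.
  have := H (flip_sign k s); rewrite ffunE eqxx flip_signK => /(_ sk).
  by rewrite (addrC (queries _ _)) (addrC (risk _ _)).
(* Equal weights [u = v = 1] on the two sign vectors give the constant [4 / 2 - 9 / 8 = 7 / 8]. *)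
have := @two_point_risk_ge _ _ req (sign_bias s) (sign_bias (flip_sign k s)) k d
  (fun tr => mean_miss d (sign_seq s) (ret tr) k)
  (fun tr => mean_miss d (sign_seq (flip_sign k s)) (ret tr) k)
  (sign_bias01 s) _ _ _ d01 _ _ _ M [::] 1 1 ler01 ler01.
rewrite -/(risk s k) -/(risk (flip_sign k s) k) -/(queries s k).
rewrite -/(queries (flip_sign k s) k) !mul1r.
rewrite (_ : 4 * (1 + 1)^-1 - 9 / 16 * (1 + 1) = 7 / 8); last by field.
apply.
- by move=> a ak; rewrite /sign_bias /hidden_bias sign_seq_flip.
- by rewrite /sign_bias /hidden_bias (negbTE kodd) sign_seqE sk.
- by rewrite /sign_bias /hidden_bias (negbTE kodd) sign_seqE ffunE eqxx sk.
- by move=> tr; exact: mean_miss_ge0.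
- by move=> tr; exact: mean_miss_ge0.
- move=> tr; rewrite (mean_miss_flip d01)//.
    by move=> t tk; rewrite sign_seq_flip// ltn_eqF.
  by rewrite !sign_seqE ffunE eqxx.
Qed.

(** Halving [risk_flip_ge] charges [7/16] to each of the [K] even periods, and the request counts
    total at most [M]. *)
Lemma sum_risk_ge :
  \sum_(s : {ffun 'I_K.*2 -> bool}) (7 / 16 * K%:R - 4 * d ^+ 2 * M%:R)
  <= \sum_(s : {ffun 'I_K.*2 -> bool}) \sum_(k < K.*2 | ~~ odd k) risk s k.
Proof.
apply: (@le_trans _ _
  (\sum_(s : {ffun 'I_K.*2 -> bool}) \sum_(k < K.*2 | ~~ odd k)
     (7 / 16 - 4 * d ^+ 2 * queries s k))).
  apply: ler_sum => s _; rewrite big_split/= sum_even_ord sumrN -mulr_sumr.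
  rewrite -[_ / _ *+ K]mulr_natr lerD2l lerN2; apply: ler_wpM2l.
    by rewrite mulr_ge0// sqr_ge0.
  by apply: sum_request_mean_le => t; exact: sign_bias01.
rewrite exchange_big [leRHS]exchange_big/=; apply: ler_sum => k kodd.
apply: (@sum_ge_flip _ _ k) => s.
have := risk_flip_ge s kodd; lra.
Qed.

(** On success the misses total at most [eps / (2 d) = K / 8]; on failure each of the [K] misses is
    still at most 1. *)
Lemma sum_risk_le s :
  \sum_(k < K.*2 | ~~ odd k) risk s k <= K%:R + - (7 / 8 * K%:R) * success s.
Proof.
rewrite -tree_mean_sum -tree_mean_affine; apply: tree_mean_le => [t|tr].
  exact: sign_bias01.
rewrite indicE; case: (boolP (ret tr \in _)) => [/set_mem G|_].
  have := eps_optimal_mean_miss_le d01 G.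
  set S := \sum_(_ < _ | _) _ => h.
  have KR0 : 0 < K%:R :> R by rewrite ltr0n.
  have : eps * (8 * S) <= eps * K%:R.
    rewrite -ler_pdivrMr//.
    by rewrite (_ : _ / _ = 2 * d * S)// dE; field; rewrite gt_eqF.
  rewrite ler_pM2l// mulr1; lra.
rewrite mulr0 addr0 -(sum_even_ord 1 K); apply: ler_sum => k _.
exact: mean_miss_le1.
Qed.

(** The averaged inequality [7/16 K - 4 d^2 M <= K - 7/8 K * success] is solved for the success.
    What matters is that [9/14] lies below the required [3/4]. *)
Lemma sum_success_le :
  \sum_(s : {ffun 'I_K.*2 -> bool}) success s
    <= \sum_(s : {ffun 'I_K.*2 -> bool})
         (9 / 14 + 32 / 7 * d ^+ 2 * M%:R / K%:R).
Proof.
have KR0 : 0 < K%:R :> R by rewrite ltr0n.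
rewrite -(ler_pM2l (mulr_gt0 (_ : 0 < 7 / 8) KR0)); last lra.
rewrite !mulr_sumr.
have h := le_trans sum_risk_ge (ler_sum _ (fun s _ => sum_risk_le s)).
rewrite -subr_ge0 -sumrB in h; rewrite -subr_ge0 -sumrB.
apply: le_trans h _; rewrite le_eqVlt; apply/orP; left; apply/eqP.
by apply: eq_bigr => s _; field; rewrite gt_eqF.
Qed.

End Risk.

(** * From average success to sample size *)

Theorem theorem1 (R : realType) :
  exists c_pol : R, 0 < c_pol /\
    forall (r : level_rule) (T K : nat) (eps : R),
      T = (2 * K)%N -> (4 <= T)%N -> 0 < eps -> eps <= T%:R / 128%:R ->
    forall (dW : measure_display) (W : measurableType dW)
      (mu : probability W R) (A : algorithm R r T W) (M : nat),
      (forall P : demand_laws R,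
         ((3%:R / 4%:R)%:E <=
          success_prob mu A M P
            (eps_optimal T (fun=> 1%R) (fun=> 1%R) P 0%R eps))%E) ->
      c_pol * (T%:R ^+ 3 / eps ^+ 2) <= M%:R.
Proof.
(* The computation ends with [3 K^3 <= 2048 eps^2 M]; as [T = 2 K], the constant is
   [3 / (8 * 2048)]. *)
exists (3 / 16384); split; first lra.
move=> r T K eps TK T4 eps0 epsT dW W mu A M hA.
rewrite mul2n in TK; subst T.
have K0 : (0 < K)%N by case: K T4 {epsT A hA}.
have KR0 : 0 < K%:R :> R by rewrite ltr0n.
have KE : K.*2%:R = 2 * K%:R :> R by rewrite -mul2n natrM.
have [d dE] : exists d, d = 4 * eps / K%:R by exists (4 * eps / K%:R).
(* The bound [eps <= T / 128 = K / 64] gives [d <= 1/16]. *)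
have d01 : 0 <= d < 2^-1.
  rewrite dE divr_ge0 ?mulr_ge0 ?ler0n ?(ltW eps0)//= ltr_pdivrMr//.
  by rewrite KE in epsT; lra.
pose G s := eps_optimal (r := r) K.*2 (fun=> 1%R) (fun=> 1%R)
  (bernoulli_laws (hidden_bias d (@sign_seq K.*2 s))) 0%R eps.
pose C : R := \sum_(s : {ffun 'I_K.*2 -> bool})
  (9 / 14 + 32 / 7 * d ^+ 2 * M%:R / K%:R).
have C_ge : (\sum_(s : {ffun 'I_K.*2 -> bool}) (3 / 4)%:E <= C%:E)%E.
  apply: (@le_trans _ _ (\sum_(s : {ffun 'I_K.*2 -> bool}) success_prob mu A M
      (bernoulli_laws (hidden_bias d (sign_seq s))) (G s))%E).
    by apply: lee_sum => s _; exact: hA.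
  (* The sum over signs passes under the seed integral by superadditivity; the bound is then shown
     seed by seed and compared with the integral of the constant [C]. *)
  apply: le_trans; first apply: lower_integral_sum.
    by move=> s w; exact: return_prob_ge0.
  rewrite -[leRHS]mule1 -(probability_setT mu) -integral_cst//.
  apply: lower_integral_le => w.
    by apply: sume_ge0 => s _; exact: return_prob_ge0.
  under eq_bigr => s _.
    rewrite return_probE; last by move=> t; exact: hidden_bias01.
    over.
  rewrite sumEFin lee_fin.
  exact: (sum_success_le K0 eps0 dE d01 (request A w) (returned A w) M).
move: C_ge; rewrite sumEFin lee_fin /C !sumr_const.
have S0 : (0 < #|{ffun 'I_K.*2 -> bool}|)%N.
  by apply/card_gt0P; exists [ffun=> true].
rewrite ler_pMn2r// => H.
(* The gap is [3/4 - 9/14 = 3/28]. *)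
have {}H : 3 / 28 <= 32 / 7 * d ^+ 2 * M%:R / K%:R by lra.
rewrite ler_pdivlMr// in H.
have {}H : 3 * K%:R ^+ 3 <= 2048 * eps ^+ 2 * M%:R.
  have -> : 2048 * eps ^+ 2 * M%:R
      = 28 * K%:R ^+ 2 * (32 / 7 * d ^+ 2 * M%:R).
    by rewrite dE; field; rewrite gt_eqF.
  have -> : 3 * K%:R ^+ 3 = 28 * K%:R ^+ 2 * (3 / 28 * K%:R) :> R by field.
  by apply: ler_wpM2l => //; rewrite mulr_ge0// sqr_ge0.
rewrite KE mulrA ler_pdivrMr ?exprn_gt0// exprMn; lra.
Qed.
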